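(* Let $\mathcal H^2$ be a two-dimensional complex Hilbert space with orthonormal basis $h_{01},h_{02}$, let $\lambda_0\in\mathbb C$ with $\operatorname{Im}\lambda_0>0$, let $T_d$ be the linear operator in $\mathcal H^2$ with matrix $\begin{pmatrix}\lambda_0&0\\0&-\bar\lambda_0\end{pmatrix}$ in this basis, let $K:\mathbb C^2\to\mathcal H^2$ be given by $K(c_1,c_2)^T=\sqrt{\operatorname{Im}\lambda_0}\,(c_1h_{01}+c_2h_{02})$, and let $$\Theta_d=\begin{pmatrix}T_d&K&I\\ \mathcal H^2&&\mathbb C^2\end{pmatrix}$$ be the canonical L-system with main operator $T_d$, channel operator $K$ and directing operator $I$ (the identity on $\mathbb C^2$). Then the c-Entropy $\mathcal S_d$ of $\Theta_d$ is $$\mathcal S_d=\ln\frac{|\lambda_0|^2+2\operatorname{Im}\lambda_0+1}{|\lambda_0|^2-2\operatorname{Im}\lambda_0+1}.$$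
   Context: $\operatorname{Im}T=\frac1{2i}(T-T^* )$. A canonical L-system is an array $\Theta=\begin{pmatrix}T&K&J\\ \mathcal H&&E\end{pmatrix}$, where $\mathcal H,E$ are Hilbert spaces with $\dim E<\infty$, $T$ is a bounded operator in $\mathcal H$ (main operator), $K:E\to\mathcal H$ is bounded (channel operator), $J$ is a bounded self-adjoint unitary operator in $E$ (directing operator), and $\operatorname{Im}T=KJK^*$. Its transfer function is $W_\Theta(z)=I-2iK^*(T-zI)^{-1}KJ$, $z\in\rho(T)$. The c-Entropy of $\Theta$ is $\mathcal S=-\operatorname{tr}\ln(|W_\Theta(-i)|)$, where $|W|=(W^*W)^{1/2}$. Convention: $\ln 0=-\infty$, and when $W_\Theta(-i)$ is singular (here exactly when $\lambda_0=i$) the value is $\mathcal S=+\infty$; correspondingly, a positive number divided by $0$ is read as $+\infty$ with $\ln(+\infty)=+\infty$. *)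

(* Defs.v *)
(* Complex numbers are R[i] for R : realType. *)
From HB Require Import structures.
From mathcomp Require Import all_boot all_order all_algebra.
From mathcomp Require Import all_classical all_reals all_analysis.
From mathcomp Require Import complex.

Set Implicit Arguments.
Unset Strict Implicit.
Unset Printing Implicit Defensive.

Import Order.TTheory GRing.Theory Num.Theory.
Import numFieldNormedType.Exports.

Local Open Scope classical_set_scope.
Local Open Scope ring_scope.
Local Open Scope complex_scope.

(* The inner product is linear in its first argument. *)
Record hilbert (R : realType) := Hilbert {
  hilbert_space :> completeNormedModType R[i];
  inner : {dot hilbert_space for @Num.conj R[i]};
  normE_inner : forall x : hilbert_space, `|x| ^+ 2 = inner x x
}.

Section Operators.
Variable R : realType.
Implicit Types H : hilbert R.

Definition bounded_operator H1 H2 (f : H1 -> H2) : Prop :=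
  linear f /\ exists M : R, forall x, `|f x| <= M%:C * `|x|.

Definition is_adjoint H1 H2 (f : H1 -> H2) (g : H2 -> H1) : Prop :=
  bounded_operator g /\ forall x y, inner H2 (f x) y = inner H1 x (g y).

(* Every bounded operator has exactly one adjoint (Riesz); the default value is
   only taken by functions that are not bounded operators. *)
Definition adjoint H1 H2 (f : H1 -> H2) : H2 -> H1 :=
  xget (fun=> 0) [set g | is_adjoint f g].

Definition imag_part H (T : H -> H) : H -> H :=
  fun x => (2 * 'i)^-1 *: (T x - adjoint T x).

Definition is_inverse H (A B : H -> H) : Prop :=
  [/\ bounded_operator B, cancel A B & cancel B A].

Definition invertible H (A : H -> H) : Prop := exists B, is_inverse A B.

Definition resolvent_set H (T : H -> H) : set R[i] :=
  [set z | invertible (fun x => T x - z *: x)].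

(* (T - zI)^-1, meaningful for z in the resolvent set of T *)
Definition resolvent H (T : H -> H) (z : R[i]) : H -> H :=
  xget (fun=> 0) [set B | is_inverse (fun x => T x - z *: x) B].

Definition positive_operator H (A : H -> H) : Prop :=
  bounded_operator A /\ forall x, 0 <= inner H (A x) x.

Definition sqrt_operator H (A : H -> H) : H -> H :=
  xget (fun=> 0) [set P | positive_operator P /\ P \o P = A].

Definition abs_operator H (A : H -> H) : H -> H :=
  sqrt_operator (adjoint A \o A).

Definition finite_dimensional H : Prop :=
  exists (n : nat) (v : 'I_n -> H),
    forall x : H, exists c : 'I_n -> R[i], x = \sum_i c i *: v i.

Definition orthonormal_basis H n (e : 'I_n -> H) : Prop :=
  (forall i j, inner H (e i) (e j) = (i == j)%:R) /\
  (forall x : H, exists c : 'I_n -> R[i], x = \sum_i c i *: e i).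

(* The operator whose matrix in the orthonormal basis e is A : the j-th
   coordinate of x is inner x (e j). *)
Definition op_of_mx H n (e : 'I_n -> H) (A : 'M[R[i]]_n) : H -> H :=
  fun x => \sum_i (\sum_j A i j * inner H x (e j)) *: e i.

(* On a finite-dimensional space; the value does not depend on the
   orthonormal basis. *)
Definition operator_trace H (A : H -> H) : R[i] :=
  xget 0 [set t | exists (n : nat) (e : 'I_n -> H),
    orthonormal_basis e /\ t = \sum_i inner H (A (e i)) (e i)].

(* Functional calculus on a finite-dimensional space: if P is self-adjoint with
   positive eigenvalues p i on an orthonormal basis e, then L multiplies e i by
   ln (p i).  Such an L depends only on P. *)
Definition is_ln_operator H (P L : H -> H) : Prop :=
  linear L /\ exists (n : nat) (e : 'I_n -> H) (p : 'I_n -> R),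
    orthonormal_basis e /\
    forall i, [/\ 0 < p i, P (e i) = (p i)%:C *: e i
                & L (e i) = (ln (p i))%:C *: e i].

Definition ln_operator H (P : H -> H) : H -> H :=
  xget (fun=> 0) [set L | is_ln_operator P L].

Record canonical_Lsystem (H E : hilbert R) := CanonicalLsystem {
  main_operator : H -> H;
  channel_operator : E -> H;
  directing_operator : E -> E;
  Lsystem_finite_dim : finite_dimensional E;
  main_bounded : bounded_operator main_operator;
  channel_bounded : bounded_operator channel_operator;
  directing_bounded : bounded_operator directing_operator;
  directing_selfadjoint : adjoint directing_operator = directing_operator;
  directing_unitary :
    cancel directing_operator (adjoint directing_operator) /\
    cancel (adjoint directing_operator) directing_operator;
  Lsystem_imag_part :
    imag_part main_operator =
    channel_operator \o directing_operator \o adjoint channel_operator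
}.

(* W(z) = I - 2i K^* (T - zI)^-1 K J, meaningful for z in the resolvent set of
   the main operator *)
Definition transfer_function (H E : hilbert R) (S : canonical_Lsystem H E)
    (z : R[i]) : E -> E :=
  fun c => c - (2 * 'i) *: adjoint (channel_operator S)
    (resolvent (main_operator S) z
      (channel_operator S (directing_operator S c))).

(* - tr ln |W(-i)|, with value +oo when W(-i) is singular.  The trace of the
   self-adjoint operator ln |W(-i)| is real. *)
Definition c_entropy (H E : hilbert R) (S : canonical_Lsystem H E) : \bar R :=
  let W := transfer_function S (- 'i) in
  if `[< invertible W >]
  then (- complex.Re (operator_trace (ln_operator (abs_operator W))))%:E
  else +oo%E.

End Operators.

(* C^n with its standard inner product.  The alias is needed because column
   vectors already carry the sup norm. *)
Definition euclid (R : realType) (n : nat) : Type := 'cV[R[i]]_n.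

Section Euclid.
Variables (R : realType) (n : nat).
Local Notation C := R[i].

HB.instance Definition _ := Vector.copy (euclid R n) 'cV[C]_n.

Definition euclid_dot (u v : euclid R n) : C :=
  \sum_i (u : 'cV[C]_n) i 0 * ((v : 'cV[C]_n) i 0)^*%R.

Lemma euclid_dot_linearl v :
  GRing.linear_for *%R ((@euclid_dot)^~ v : euclid R n -> C).
Proof.
move=> a x y; rewrite /euclid_dot mulr_sumr -big_split /=.
by apply: eq_bigr => i _; rewrite !mxE mulrDl mulrA.
Qed.

Lemma euclid_dot_linearr u :
  GRing.linear_for (@Num.conj C \; *%R) (euclid_dot u).
Proof.
move=> a x y; rewrite /euclid_dot /= mulr_sumr -big_split /=.
apply: eq_bigr => i _.
by rewrite !mxE rmorphD rmorphM mulrDr mulrCA.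
Qed.

HB.instance Definition _ := @bilinear_isBilinear.Build C (euclid R n)
  (euclid R n) C *%R (@Num.conj C \; *%R) euclid_dot
  (euclid_dot_linearl, euclid_dot_linearr).

Lemma euclid_dot_herm u v :
  euclid_dot u v = (-1) ^+ false * (@Num.conj C) (euclid_dot v u).
Proof.
rewrite expr0 mul1r /euclid_dot rmorph_sum; apply: eq_bigr => i _.
by rewrite rmorphM /= conjCK mulrC.
Qed.

HB.instance Definition _ := @isHermitianSesquilinear.Build C (euclid R n)
  false (@Num.conj C) euclid_dot euclid_dot_herm.

Lemma euclid_dot_gt0 (u : euclid R n) : u != 0 -> 0 < euclid_dot u u.
Proof.
move=> u0; have u_ge0 i : 0 <= (u : 'cV[C]_n) i 0 * ((u : 'cV[C]_n) i 0)^*%R.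
  exact: mul_conjC_ge0.
rewrite lt_def sumr_ge0 // andbT; apply: contra u0.
rewrite psumr_eq0 // => /allP u_eq0; apply/eqP/matrixP => i j.
have := u_eq0 i (mem_index_enum _).
by rewrite (ord1 j) mxE mul_conjC_eq0 => /eqP.
Qed.

HB.instance Definition _ :=
  @isDotProduct.Build C (euclid R n) euclid_dot euclid_dot_gt0.

Definition euclid_norm (u : euclid R n) : C := sqrtC (euclid_dot u u).

Lemma euclid_normD u v :
  euclid_norm (u + v) <= euclid_norm u + euclid_norm v.
Proof. exact: (triangle_lerif (@euclid_dot : {dot _ for _})). Qed.

Lemma euclid_normZ (a : C) u : euclid_norm (a *: u) = `|a| * euclid_norm u.
Proof.
rewrite /euclid_norm (dnormZ (@euclid_dot : {dot _ for _})).
by rewrite rootCMl ?exprn_ge0 // sqrCK.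
Qed.

Lemma euclid_norm_eq0 u : euclid_norm u = 0 -> u = 0.
Proof.
by move/eqP; rewrite (sqrt_dnorm_eq0 (@euclid_dot : {dot _ for _})) => /eqP.
Qed.

HB.instance Definition _ := @Lmodule_isNormed.Build C (euclid R n)
  euclid_norm euclid_normD euclid_normZ euclid_norm_eq0.

Lemma euclid_coord_le (u : euclid R n) i : `|(u : 'cV[C]_n) i 0| <= `|u|.
Proof.
rewrite -(ler_pXn2r (n := 2)) ?nnegrE // sqrtCK normCK.
rewrite [leRHS](bigD1 i) //= lerDl; apply: sumr_ge0 => j _.
exact: mul_conjC_ge0.
Qed.

Lemma euclid_norm_le (u : euclid R n) : `|u| <= \sum_i `|(u : 'cV[C]_n) i 0|.
Proof.
have {1}-> : u = \sum_i (u : 'cV[C]_n) i 0 *: (delta_mx i 0 : euclid R n).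
  rewrite [LHS](@matrix_sum_delta C n 1 u); apply: eq_bigr => i _.
  by rewrite big_ord1.
apply: le_trans (ler_norm_sum _ _ _) _; apply: ler_sum => i _.
rewrite normrZ (_ : `|_ : euclid R n| = 1) ?mulr1 //.
suff : euclid_dot (delta_mx i 0) (delta_mx i 0) = 1.
  by move=> dot1; rewrite [LHS](congr1 sqrtC dot1) sqrtC1.
rewrite /euclid_dot (bigD1 i) //= big1 ?addr0 => [|j ji].
  by rewrite mxE !eqxx mul1r conjC1.
by rewrite mxE (negbTE ji) mul0r.
Qed.

Lemma euclid_complete (F : set_system (euclid R n)) :
  ProperFilter F -> cauchy F -> cvg F.
Proof.
move=> FF Fc; move/cauchy_ballP : Fc => Fc.
have coord_cvg (f : C -> R) (i : 'I_n) :
    (forall a b : C, `|f a - f b|%:C <= `|a - b|) ->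
    exists l : R, forall e, 0 < e ->
      \forall x \near F, `|l - f ((x : 'cV[C]_n) i 0)| < e.
  move=> f_le; pose g (x : euclid R n) : R := f ((x : 'cV[C]_n) i 0).
  have /cauchy_cvg/cvg_ex[l /cvgrPdist_lt gl] : cauchy (g @ F).
    apply/cauchy_ballP => e e0.
    have eC : 0 < e%:C by rewrite ltcR.
    case: (Fc _ eC) => -[A B] [/= FA FB] AB.
    exists (g @` A, g @` B).
      by split; [apply: filterS FA | apply: filterS FB] => x Ax; exists x.
    move=> _ [/= [x Ax <-] [y By <-]]; have /= xy := AB (x, y) (conj Ax By).
    rewrite /ball /= -ltcR; apply: le_lt_trans (f_le _ _) _.
    by apply: le_lt_trans xy; have := euclid_coord_le (x - y) i; rewrite !mxE.
  by exists l => e /gl.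
have Re_le (a b : C) : `|complex.Re a - complex.Re b|%:C <= `|a - b|.
  by rewrite -raddfB; exact: normc_ge_Re.
have Im_le (a b : C) : `|complex.Im a - complex.Im b|%:C <= `|a - b|.
  rewrite -raddfB; case: (a - b) => x y /=.
  by rewrite normc_def /= lecR -sqrtr_sqr ler_wsqrtr // lerDr sqr_ge0.
pose a i := projT1 (cid (coord_cvg _ i Re_le)).
pose b i := projT1 (cid (coord_cvg _ i Im_le)).
have aP i := projT2 (cid (coord_cvg _ i Re_le)).
have bP i := projT2 (cid (coord_cvg _ i Im_le)).
apply/cvg_ex; exists ((\col_i (a i +i* b i)) : 'cV[C]_n).
apply/cvgrPdist_lt => e e0.
have [r r0 er] : exists2 r : R, 0 < r & e = r%:C.
  by case: e e0 => r s; rewrite ltcE /= => /andP[/eqP-> r0]; exists r.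
pose d := r / (2 * n.+1%:R).
have d0 : 0 < d by rewrite divr_gt0 // mulr_gt0.
have near_all : \forall x \near F, forall i : 'I_n,
    `|a i - complex.Re ((x : 'cV[C]_n) i 0)| < d /\
    `|b i - complex.Im ((x : 'cV[C]_n) i 0)| < d.
  apply: filter_forall => i.
  by apply: filterS2 (aP i _ d0) (bP i _ d0) => x; split.
apply: filterS near_all => x xab.
apply: le_lt_trans (euclid_norm_le _) _.
have coord_lt i : `|((\col_i (a i +i* b i)) - (x : 'cV[C]_n)) i 0|
    <= (2 * d)%:C.
  have [ad bd] := xab i.
  rewrite !mxE; case: ((x : 'cV[C]_n) i 0) ad bd => y z /= ad bd.
  have -> : (a i +i* b i - (y +i* z)) =
      (a i - y)%:C + 'i * (b i - z)%:C by simpc.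
  apply: le_trans (ler_normD _ _) _; rewrite normrM.
  rewrite !normc_def /= !expr0n !expr1n /= !addr0 add0r sqrtr1 mul1r !sqrtr_sqr.
  by rewrite -rmorphD lecR mulr_natl mulr2n lerD // ltW.
apply: le_lt_trans (ler_sum _ (fun i _ => coord_lt i)) _.
rewrite sumr_const card_ord er -rmorphMn ltcR /d.
rewrite mulrCA invfM mulVKf ?pnatr_eq0 // -mulr_natr -mulrA gtr_pMr //.
by rewrite mulrC ltr_pdivrMr // mul1r ltr_nat.
Qed.

HB.instance Definition _ :=
  Uniform_isComplete.Build (euclid R n) euclid_complete.

Lemma euclid_normE (u : euclid R n) : `|u| ^+ 2 = euclid_dot u u.
Proof. exact: sqrtCK. Qed.

Definition euclid_space : hilbert R := Hilbert euclid_normE.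

End Euclid.

Section Helpers.
Variable R : realType.
Implicit Types H : hilbert R.
Local Notation C := R[i].

Lemma innerC H (x y : H) : inner H x y = (inner H y x)^*%R.
Proof. by rewrite [LHS]hermC expr0 mul1r. Qed.

Lemma inner_suml H n (c : 'I_n -> C) (v : 'I_n -> H) (y : H) :
  inner H (\sum_i c i *: v i) y = \sum_i c i * inner H (v i) y.
Proof.
by rewrite linear_sumlz; apply: eq_bigr => i _; rewrite linearZl_LR.
Qed.

Lemma inner_sumr H n (c : 'I_n -> C) (v : 'I_n -> H) (y : H) :
  inner H y (\sum_i c i *: v i) = \sum_i (c i)^*%R * inner H y (v i).
Proof.
by rewrite linear_sumr; apply: eq_bigr => i _; rewrite linearZr_LR.
Qed.

Lemma inner_inj H (u v : H) : (forall x, inner H x u = inner H x v) -> u = v.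
Proof.
move=> uv; apply/eqP; rewrite -subr_eq0 -(dnorm_eq0 (inner H)).
by rewrite linearBr /= uv subrr.
Qed.

Lemma basis_coord H n (e : 'I_n -> H) : orthonormal_basis e ->
  forall x, x = \sum_i inner H x (e i) *: e i.
Proof.
move=> [on sp] x; have [c xE] := sp x; rewrite {1}xE; apply: eq_bigr => i _.
congr (_ *: _); rewrite xE inner_suml (bigD1 i) //= on eqxx mulr1 big1 ?addr0 //.
by move=> j ji; rewrite on (negbTE ji) mulr0.
Qed.

Lemma coord_le_norm H n (e : 'I_n -> H) : orthonormal_basis e ->
  forall x i, `|inner H x (e i)| <= `|x|.
Proof.
move=> eB x i; rewrite -(ler_pXn2r (n := 2)) ?nnegrE //.
rewrite normE_inner {3}(basis_coord eB x) inner_sumr (bigD1 i) //=.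
rewrite normCKC lerDl; apply: sumr_ge0 => j _.
by rewrite mulrC mul_conjC_ge0.
Qed.

Lemma basis_bounded H1 H2 n (e : 'I_n -> H1) (f : H1 -> H2) :
  orthonormal_basis e -> linear f -> bounded_operator f.
Proof.
move=> eB lf; split => //.
pose g := HB.pack_for {linear H1 -> H2} f (GRing.isLinear.Build _ _ _ _ f lf).
exists (complex.Re (\sum_i `|f (e i)|)) => x.
have -> : (complex.Re (\sum_i `|f (e i)|))%:C = \sum_i `|f (e i)|.
  by rewrite RRe_real // ger0_real // sumr_ge0.
rewrite {1}(basis_coord eB x) -[f _]/(g _) linear_sum mulr_suml.
apply: le_trans (ler_norm_sum _ _ _) _; apply: ler_sum => i _.
by rewrite linearZ normrZ mulrC ler_wpM2l // coord_le_norm.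
Qed.

Lemma adjointE H1 H2 (f : H1 -> H2) (g : H2 -> H1) :
  is_adjoint f g -> adjoint f = g.
Proof.
move=> fg; rewrite /adjoint; case: xgetP => [g' _ [_ fg']|/(_ g)] //.
by apply/funext => y; apply: inner_inj => x; rewrite -fg' -fg.2.
Qed.

Lemma adjoint_id H n (e : 'I_n -> H) : orthonormal_basis e ->
  adjoint (@idfun H) = idfun.
Proof. by move=> eB; apply: adjointE; split => //; apply: basis_bounded eB _. Qed.

Lemma op_of_mx_linear H n (e : 'I_n -> H) A : linear (op_of_mx e A).
Proof.
move=> a x y; rewrite /op_of_mx scaler_sumr -big_split /=.
apply: eq_bigr => i _; rewrite scalerA -scalerDl; congr (_ *: _).
rewrite mulr_sumr -big_split /=; apply: eq_bigr => j _.
by rewrite linearDl linearZl_LR /= mulrDr mulrCA.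
Qed.

Lemma adjoint_op_of_mx H n (e : 'I_n -> H) A : orthonormal_basis e ->
  adjoint (op_of_mx e A) = op_of_mx e (map_mx (@Num.conj C) A^T).
Proof.
move=> eB; apply: adjointE; split.
  exact: basis_bounded eB (@op_of_mx_linear _ _ _ _).
move=> x y; rewrite inner_suml inner_sumr.
under eq_bigr do rewrite mulr_suml; rewrite exchange_big /=.
apply: eq_bigr => i _; rewrite rmorph_sum mulr_suml; apply: eq_bigr => j _.
rewrite !mxE rmorphM /= conjCK -innerC -!mulrA; congr (_ * _).
by rewrite mulrC.
Qed.

Lemma euclid_basis n :
  orthonormal_basis (fun i => delta_mx i 0 : euclid_space R n).
Proof.
split=> [i j|x].
  rewrite [LHS](bigD1 i) //= big1 ?addr0 => [|k ki].
    by rewrite !mxE !eqxx mul1r andbT; case: eqP; rewrite ?conjC1 ?conjC0.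
  by rewrite !mxE (negbTE ki) mul0r.
exists (fun i => (x : 'cV[C]_n) i 0).
rewrite [LHS](@matrix_sum_delta C n 1 x); apply: eq_bigr => i _.
by rewrite big_ord1.
Qed.

End Helpers.

Section ThetaD.
Variables (R : realType) (H : hilbert R) (h : 'I_2 -> H) (l0 : R[i]).
Local Notation C := R[i].

Definition Td_matrix : 'M[C]_2 :=
  \matrix_(i, j) if i == j then [:: l0; - l0^*%R]`_i else 0.

Definition Td : H -> H := op_of_mx h Td_matrix.

Definition Kd : euclid_space R 2 -> H :=
  fun c => (Num.sqrt (complex.Im l0))%:C *: \sum_i (c : 'cV[C]_2) i 0 *: h i.

Hypotheses (hB : orthonormal_basis h) (Im_l0 : 0 < complex.Im l0).

Lemma Kd_is_linear : linear Kd.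
Proof.
move=> a x y; rewrite /Kd scalerA [a * _]mulrC -scalerA -scalerDr.
congr (_ *: _); rewrite scaler_sumr -big_split /=; apply: eq_bigr => i _.
by rewrite !mxE scalerDl scalerA.
Qed.

Lemma adjoint_Kd : adjoint Kd = fun x =>
  \col_i ((Num.sqrt (complex.Im l0))%:C * inner H x (h i)) : euclid_space R 2.
Proof.
apply: adjointE; split.
  apply: basis_bounded hB _ => a x y; apply/matrixP => i j.
  by rewrite !mxE linearDl linearZl_LR /= mulrDr mulrCA.
move=> x y; rewrite /Kd linearZl_LR /= inner_suml mulr_sumr; apply: eq_bigr => i _.
rewrite mxE rmorphM /= -innerC mulrCA; congr (_ * (_ * _)).
by apply/esym/CrealP; rewrite complex_real.
Qed.

Lemma imag_part_Td : imag_part Td = Kd \o idfun \o adjoint Kd.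
Proof.
apply/funext => x; rewrite /imag_part adjoint_op_of_mx // adjoint_Kd /Kd /=.
rewrite /Td /op_of_mx -sumrB !scaler_sumr; apply: eq_bigr => i _.
rewrite mxE -scalerBl !scalerA mulrA -rmorphM -expr2 sqr_sqrtr ?ltW //.
congr (_ *: _); rewrite -sumrB (bigD1 i) //= big1 ?addr0 => [|j ji]; last first.
  by rewrite !mxE eq_sym (negbTE ji) conjC0 !mul0r subrr.
rewrite -mulrBl mulrA !mxE eqxx; congr (_ * _).
have -> : [:: l0; - l0^*%R]`_i - (@Num.conj C [:: l0; - l0^*%R]`_i) =
          l0 - l0^*%R.
  case: i => -[|[|//]] //= _.
  by rewrite rmorphN /= conjCK opprK addrC.
have -> : l0 - l0^*%R = 2 * 'i * (complex.Im l0)%:C.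
  case: l0 => a b; apply/eqP; rewrite eq_complex /=.
  rewrite !(mulr0, mul0r, addr0, add0r, mulr1, subrr) opprK mulrDl mul1r.
  by rewrite oppr0 mul0r addr0 !eqxx.
apply: (@mulKf C (2 * 'i)); rewrite mulf_neq0 ?pnatr_eq0 //.
by rewrite eq_complex /= oner_eq0 andbF.
Qed.

Lemma finite_dim_C2 : finite_dimensional (euclid_space R 2).
Proof. by exists 2%N; eexists; case: (euclid_basis R 2) => _; exact. Qed.

Lemma adjoint_id2 : adjoint (@idfun (euclid_space R 2)) = idfun.
Proof. exact: adjoint_id (euclid_basis R 2). Qed.

Definition Theta_d : canonical_Lsystem H (euclid_space R 2).
Proof.
refine (@CanonicalLsystem R H (euclid_space R 2) Td Kd idfun finite_dim_C2
  _ _ _ adjoint_id2 _ imag_part_Td).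
- exact: basis_bounded hB (@op_of_mx_linear _ _ _ _ _).
- exact: basis_bounded (euclid_basis R 2) Kd_is_linear.
- by apply: basis_bounded (euclid_basis R 2) _.
- by rewrite adjoint_id2.
Defined.

End ThetaD.

(* Main.v *)
From HB Require Import structures.
Require Import Defs.
From mathcomp Require Import all_boot all_order all_algebra.
From mathcomp Require Import all_classical all_reals all_analysis.
From mathcomp Require Import complex ring.

Import Order.TTheory GRing.Theory Num.Theory.
Import numFieldNormedType.Exports.

Local Open Scope ring_scope.
Local Open Scope complex_scope.

(** Everything is diagonal.  The main operator is diagonal in [h], and [Kd]
    is [sqrt (Im l0)] times the unitary map carrying the standard basis to [h],
    so the transfer function at [-i] is diagonal in the standard basis, with
    entries
      [1 - 2 i Im z / (z + i) = (z^* + i) / (z + i)],  [z] an eigenvalue of [Td]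
    ([transfer_function_Theta_d]).  The squared modulus of this number is
      [(|z|^2 - 2 Im z + 1) / (|z|^2 + 2 Im z + 1)],
    and depends only on [|z|] and [Im z], which are the same for [l0] and for
    [- l0^*].  Hence both eigenvalues of [|W(-i)|] equal the square root [s] of
    this quotient with [z = l0], and the entropy is [- 2 ln s = - ln (s^2)], the
    logarithm of the inverse quotient.  When the numerator vanishes, [W(-i)] is
    zero, hence singular, and both sides are [+oo].

    The operator-theoretic notions are specified up to a choice, so each of
    them must be shown to have only one possible value on a diagonal operator:
    the resolvent, the positive square root ([sqrt_diag_op]), the logarithm
    ([ln_diag_op]) and the trace ([trace_diag_op]).  Each is then the diagonal
    operator, or the sum, computed entrywise. *)

(** * Functional calculus of diagonal operators *)

Section DiagonalOperators.
Set Implicit Arguments.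
Unset Strict Implicit.

Lemma normc_gt0 (R : rcfType) (z : R[i]) : (0 < Normc.normc z) = (z != 0).
Proof. by rewrite -ltcR; exact: (normr_gt0 (z : R[i])). Qed.

Lemma inner_sum_basis (R : realType) (H : hilbert R) n (e : 'I_n -> H)
    (eB : orthonormal_basis e) (c : 'I_n -> R[i]) i :
  inner H (\sum_j c j *: e j) (e i) = c i.
Proof.
rewrite inner_suml (bigD1 i) //= eB.1 eqxx mulr1 big1 ?addr0 // => j ji.
by rewrite eB.1 (negbTE ji) mulr0.
Qed.

Variables (R : realType) (H : hilbert R) (n : nat) (e : 'I_n -> H).
Local Notation C := R[i].
Implicit Types (d : 'I_n -> C) (A : H -> H).

Definition diag_op d : H -> H :=
  fun x => \sum_i (d i * inner H x (e i)) *: e i.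

Lemma diag_op_linear d : linear (diag_op d).
Proof.
move=> a x y; rewrite /diag_op scaler_sumr -big_split /=.
apply: eq_bigr => i _; rewrite scalerA -scalerDl; congr (_ *: _).
by rewrite linearDl linearZl_LR /= mulrDr mulrCA.
Qed.

Hypothesis eB : orthonormal_basis e.

Lemma coord_inj x y : (forall i, inner H x (e i) = inner H y (e i)) -> x = y.
Proof.
move=> xy; rewrite (basis_coord eB x) (basis_coord eB y).
by apply: eq_bigr => i _; rewrite xy.
Qed.

Lemma inner_diag_op d x i : inner H (diag_op d x) (e i) = d i * inner H x (e i).
Proof. exact: inner_sum_basis eB _ i. Qed.

Lemma diag_op_basis d i : diag_op d (e i) = d i *: e i.
Proof.
apply: coord_inj => j; rewrite inner_diag_op linearZl_LR /= eB.1.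
by have [->|] := eqVneq i j; rewrite ?mulr0.
Qed.

Lemma linear_diag_opE A d :
  linear A -> (forall i, A (e i) = d i *: e i) -> A = diag_op d.
Proof.
move=> lA Ae; apply/funext => x.
pose A' := HB.pack_for {linear H -> H} A (GRing.isLinear.Build _ _ _ _ A lA).
rewrite {1}(basis_coord eB x) -[A _]/(A' _) linear_sum; apply: eq_bigr => i _.
by rewrite linearZ /= Ae scalerA mulrC.
Qed.

Lemma diag_op_bounded d : bounded_operator (diag_op d).
Proof. exact: basis_bounded eB (diag_op_linear d). Qed.

Lemma diag_op_comp d1 d2 :
  diag_op d1 \o diag_op d2 = diag_op (fun i => d1 i * d2 i).
Proof.
by apply/funext => x; apply: coord_inj => i; rewrite /= !inner_diag_op mulrA.
Qed.

Lemma adjoint_diag_op d : adjoint (diag_op d) = diag_op (fun i => (d i)^*%R).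
Proof.
apply: adjointE; split; first exact: diag_op_bounded.
move=> x y; rewrite inner_suml inner_sumr; apply: eq_bigr => i _.
by rewrite rmorphM /= conjCK -innerC mulrAC.
Qed.

Lemma diag_op_inverse d : (forall i, d i != 0) ->
  is_inverse (diag_op d) (diag_op (fun i => (d i)^-1)).
Proof.
move=> d0; split; first exact: diag_op_bounded.
  by move=> x; apply: coord_inj => i; rewrite !inner_diag_op mulKf.
by move=> x; apply: coord_inj => i; rewrite !inner_diag_op mulVKf.
Qed.

Lemma invertible_diag_op d : invertible (diag_op d) <-> forall i, d i != 0.
Proof.
split=> [[B [[lB _] AB _]] i|d0]; last first.
  by exists (diag_op (fun i => (d i)^-1)); exact: diag_op_inverse.
apply/eqP => di0.
pose B' := HB.pack_for {linear H -> H} B (GRing.isLinear.Build _ _ _ _ B lB).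
have := AB (e i); rewrite diag_op_basis di0 scale0r -[B 0]/(B' 0) linear0 => e0.
by have := eB.1 i i; rewrite -e0 linear0l eqxx => /eqP; rewrite eq_sym oner_eq0.
Qed.

Lemma resolvent_diag_op d z : (forall i, d i != z) ->
  resolvent (diag_op d) z = diag_op (fun i => (d i - z)^-1).
Proof.
move=> dz; pose A := fun x => diag_op d x - z *: x.
have AE : A = diag_op (fun i => d i - z).
  apply/funext => x; apply: coord_inj => i.
  by rewrite linearBl linearZl_LR /= !inner_diag_op mulrBl.
have [| _ AK KA] := @diag_op_inverse (fun i => d i - z).
  by move=> i; rewrite subr_eq0.
have bd := diag_op_bounded (fun i => (d i - z)^-1).
rewrite /resolvent -/A AE.
case: xgetP => [B _ [_ BK _]|/(_ _ (And3 bd AK KA))] //.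
by apply/funext => x; rewrite -{1}(KA x) BK.
Qed.

(** A positive square root [Q] of an operator with eigenvalue [s^2], [s > 0],
    has the same eigenvectors: if [e] belongs to [s^2] and [y = Q e - s e], then
    [Q y + s y = (Q^2 - s^2) e = 0], so [y] would be an eigenvector of [Q] for
    the negative number [- s], which positivity of [Q] forbids unless
    [y = 0]. *)
Lemma sqrt_diag_op (p : 'I_n -> R) : (forall i, 0 < p i) ->
  sqrt_operator (diag_op (fun i => (p i ^+ 2)%:C)) =
  diag_op (fun i => (p i)%:C).
Proof.
move=> p0; set P := diag_op (fun i => (p i)%:C).
have PP : positive_operator P /\ P \o P = diag_op (fun i => (p i ^+ 2)%:C).
  split; last first.
    by rewrite diag_op_comp; congr diag_op; apply/funext => i; rewrite -rmorphM.
  split; first exact: diag_op_bounded.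
  move=> x; rewrite inner_suml; apply: sumr_ge0 => i _.
  rewrite -mulrA (innerC (e i)); apply: mulr_ge0; last exact: mul_conjC_ge0.
  by rewrite ler0c ltW.
rewrite /sqrt_operator; case: xgetP => [Q _ [[[lQ _] Q0] QQ]|/(_ _ PP)] //.
apply: linear_diag_opE => // i.
pose Q' := HB.pack_for {linear H -> H} Q (GRing.isLinear.Build _ _ _ _ Q lQ).
pose y := Q' (e i) - (p i)%:C *: e i.
have Qy : Q y = - ((p i)%:C *: y).
  rewrite -[Q y]/(Q' y) linearB linearZ /=.
  have -> : Q (Q (e i)) = (Q \o Q) (e i) by [].
  by rewrite QQ diag_op_basis scalerBr scalerA -rmorphM -expr2 opprB.
apply/eqP; rewrite -subr_eq0 -/y -(dnorm_eq0 (inner H)); apply/eqP/le_anti.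
rewrite [X in _ && X]dnorm_ge0 andbT.
have := Q0 y; rewrite Qy linearNl linearZl_LR /= oppr_ge0.
by rewrite pmulr_rle0 // ltcR.
Qed.

(** A logarithm of [P] may be built from another eigenbasis [f] of [P], with
    eigenvalues [q].  But [e i] only has components along the [f k] for which
    [q k = p i], and there both logarithms multiply by [ln (p i)]. *)
Lemma ln_diag_op (p : 'I_n -> R) : (forall i, 0 < p i) ->
  ln_operator (diag_op (fun i => (p i)%:C)) = diag_op (fun i => (ln (p i))%:C).
Proof.
move=> p0; set P := diag_op _; set L := diag_op _.
have PL : is_ln_operator P L.
  split; first exact: diag_op_linear.
  by exists n, e, p; split => // i; split => //; exact: diag_op_basis.
rewrite /ln_operator.
case: xgetP => [L' _ [lL [m [f [q [fB fP]]]]]|/(_ _ PL)] //.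
apply: linear_diag_opE => // i.
pose L1 := HB.pack_for {linear H -> H} L' (GRing.isLinear.Build _ _ _ _ L' lL).
pose P1 := HB.pack_for {linear H -> H} P
  (GRing.isLinear.Build _ _ _ _ P (diag_op_linear _)).
have fL k : L' (f k) = (ln (q k))%:C *: f k by have [] := fP k.
have fPP k : P (f k) = (q k)%:C *: f k by have [] := fP k.
have qp k : (q k == p i) || (inner H (e i) (f k) == 0).
  have : inner H (P1 (e i)) (f k) = (p i)%:C * inner H (e i) (f k).
    by rewrite [P1 _]diag_op_basis linearZl_LR.
  rewrite {1}(basis_coord fB (e i)) linear_sum.
  under eq_bigr => j _ do rewrite linearZ /= fPP scalerA.
  rewrite (inner_sum_basis fB) mulrC => /eqP; rewrite -subr_eq0 -mulrBl.
  by rewrite mulf_eq0 -rmorphB /= fmorph_eq0 subr_eq0.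
rewrite -[L' _]/(L1 _) {1}(basis_coord fB (e i)) linear_sum.
rewrite {2}(basis_coord fB (e i)) scaler_sumr; apply: eq_bigr => k _.
rewrite linearZ /= fL !scalerA.
by have /orP[/eqP->|/eqP->] := qp k; [rewrite mulrC | rewrite !(mul0r, mulr0)].
Qed.

(** In a basis [f] the diagonal sum is the double sum of
    [d i |<e i, f k>|^2]; summing over [k] first leaves [d i |e i|^2 = d i]. *)
Lemma trace_diag_op d : operator_trace (diag_op d) = \sum_i d i.
Proof.
have traceE m (f : 'I_m -> H) : orthonormal_basis f ->
    \sum_k inner H (diag_op d (f k)) (f k) = \sum_i d i.
  move=> fB; under eq_bigr => k _ do rewrite inner_suml.
  rewrite exchange_big /=; apply: eq_bigr => i _.
  under eq_bigr => k _ do rewrite -mulrA.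
  rewrite -mulr_sumr -[RHS]mulr1; congr (_ * _).
  have <- : inner H (e i) (e i) = 1 by rewrite eB.1 eqxx.
  rewrite {4}(basis_coord fB (e i)) inner_sumr.
  by apply: eq_bigr => k _; rewrite -innerC.
rewrite /operator_trace; case: xgetP => [t _ [m [f [fB ->]]]|].
  exact: traceE.
by move=> /(_ (\sum_i d i)) []; exists n, e; split => //; rewrite traceE.
Qed.

Lemma abs_diag_op d : (forall i, d i != 0) ->
  abs_operator (diag_op d) = diag_op (fun i => (Normc.normc (d i))%:C).
Proof.
move=> d0; rewrite -sqrt_diag_op => [|i]; last by rewrite normc_gt0.
rewrite /abs_operator adjoint_diag_op diag_op_comp.
congr (sqrt_operator (diag_op _)).
by apply/funext => i; rewrite rmorphXn /= -normCKC.
Qed.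

Lemma trace_ln_abs_diag_op d : (forall i, d i != 0) ->
  operator_trace (ln_operator (abs_operator (diag_op d))) =
  (\sum_i ln (Normc.normc (d i)))%:C.
Proof.
move=> d0; rewrite abs_diag_op // ln_diag_op ?trace_diag_op ?rmorph_sum // => i.
by rewrite normc_gt0.
Qed.

End DiagonalOperators.

(** * The transfer function at the point [-i] *)

Section TransferFunction.
Set Implicit Arguments.
Unset Strict Implicit.
Variable R : realType.
Local Notation C := R[i].

(** The contribution of an eigenvalue [z] of the main operator to the spectrum
    of [W(-i)]: the value at [-i] of the Blaschke factor with pole [z]. *)
Definition transfer_eigenvalue (z : C) : C := (z^*%R + 'i%R) / (z + 'i%R).

Lemma sqr_normc_transfer_eigenvalue (z : C) :
  Normc.normc (transfer_eigenvalue z) ^+ 2 =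
  (Normc.normc z ^+ 2 - 2 * complex.Im z + 1)
  / (Normc.normc z ^+ 2 + 2 * complex.Im z + 1).
Proof.
have sqE (a b : R) : Normc.normc (a +i* b) ^+ 2 = a ^+ 2 + b ^+ 2.
  by rewrite /= sqr_sqrtr // addr_ge0 ?sqr_ge0.
rewrite /transfer_eigenvalue Normc.normcM Normc.normcV exprMn exprVn.
rewrite -complexiE; case: z => a b /=.
rewrite -[Num.sqrt (a ^+ 2 + b ^+ 2)]/(Normc.normc (a +i* b)).
by congr (_ / _); rewrite !sqE; ring.
Qed.

Lemma addi_neq0 (z : C) : 0 < complex.Im z -> z + 'i%R != 0.
Proof.
rewrite -complexiE; case: z => a b /= b0; rewrite eq_complex /= negb_and.
by rewrite (gt_eqF (addr_gt0 b0 ltr01)) orbT.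
Qed.

Lemma transfer_eigenvalueE (z : C) : 0 < complex.Im z ->
  1 - 2 * 'i%R * (complex.Im z)%:C / (z + 'i%R) = transfer_eigenvalue z.
Proof.
move=> z0; rewrite /transfer_eigenvalue.
rewrite -[X in X - _](divff (addi_neq0 z0)) -mulrBl; congr (_ / _).
rewrite -complexiE; case: z {z0} => a b; apply/eqP.
by rewrite eq_complex /=; apply/andP; split; apply/eqP; ring.
Qed.

Variables (H : hilbert R) (h : 'I_2 -> H) (l0 : C).
Hypotheses (hB : orthonormal_basis h) (Im_l0 : 0 < complex.Im l0).

Definition eigenvalue_d (i : 'I_2) : C := [:: l0; - l0^*%R]`_i.

Lemma Im_eigenvalue_d i : complex.Im (eigenvalue_d i) = complex.Im l0.
Proof.
rewrite /eigenvalue_d; case: i => -[|[|//]] //= _.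
by case: (l0) => a b /=; rewrite opprK.
Qed.

Lemma normc_eigenvalue_d i : Normc.normc (eigenvalue_d i) = Normc.normc l0.
Proof.
rewrite /eigenvalue_d; case: i => -[|[|//]] //= _.
by case: (l0) => a b /=; rewrite opprK sqrrN.
Qed.

Lemma Td_diag_op : Td h l0 = diag_op h eigenvalue_d.
Proof.
apply/funext => x; apply: eq_bigr => i _; congr (_ *: _).
rewrite (bigD1 i) //= big1 ?addr0 => [|j ji]; first by rewrite mxE eqxx.
by rewrite mxE eq_sym (negbTE ji) mul0r.
Qed.

Lemma transfer_function_Theta_d :
  transfer_function (Theta_d hB Im_l0) (- 'i%R) =
  diag_op (fun i => delta_mx i 0 : euclid_space R 2)
    (fun i => transfer_eigenvalue (eigenvalue_d i)).
Proof.
have Im_gt0 i : 0 < complex.Im (eigenvalue_d i) by rewrite Im_eigenvalue_d.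
have inner_std (c : euclid_space R 2) i :
    inner _ c (delta_mx i 0 : euclid_space R 2) = (c : 'cV[C]_2) i 0.
  rewrite [LHS](bigD1 i) //= big1 ?addr0 => [|j ji].
    by rewrite mxE !eqxx conjC1 mulr1.
  by rewrite mxE (negbTE ji) conjC0 mulr0.
apply/funext => c; apply: (coord_inj (euclid_basis R 2)) => i.
rewrite inner_diag_op; last exact: euclid_basis.
rewrite /transfer_function /= adjoint_Kd // Td_diag_op.
rewrite resolvent_diag_op // => [|k]; last first.
  by rewrite -subr_eq0 opprK addi_neq0.
rewrite !inner_std !mxE inner_diag_op // /Kd linearZl_LR /=.
rewrite (inner_sum_basis hB) -transfer_eigenvalueE // Im_eigenvalue_d opprK.
(* one factor [sqrt (Im l0)] comes from [Kd], the other from its adjoint *)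
rewrite -[in RHS](sqr_sqrtr (ltW Im_l0)) rmorphXn /=; ring.
Qed.

End TransferFunction.

Theorem theorem2 (R : realType) (H : hilbert R) (h : 'I_2 -> H) (l0 : R[i])
    (hB : orthonormal_basis h) (Im_l0 : 0 < complex.Im l0) :
  c_entropy (Theta_d hB Im_l0) =
  lne ((Normc.normc l0 ^+ 2 + 2 * complex.Im l0 + 1)%:E
       / (Normc.normc l0 ^+ 2 - 2 * complex.Im l0 + 1)%:E)%E.
Proof.
set p := _ + 1; set m := _ - _ + 1.
have p0 : 0 < p by rewrite ltr_wpDl // addr_ge0 ?sqr_ge0 // mulr_ge0 // ltW.
pose d i := transfer_eigenvalue (eigenvalue_d l0 i).
have normd i : Normc.normc (d i) ^+ 2 = m / p.
  by rewrite sqr_normc_transfer_eigenvalue Im_eigenvalue_d normc_eigenvalue_d.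
have d_eq0 i : (d i == 0) = (m == 0).
  have -> : (m == 0) = (Normc.normc (d i) ^+ 2 == 0).
    by rewrite normd mulf_eq0 invr_eq0 (gt_eqF p0) orbF.
  rewrite sqrf_eq0; apply/eqP/eqP => [->|/Normc.eq0_normc //].
  by rewrite Normc.normc0.
rewrite /c_entropy transfer_function_Theta_d -/d.
case: asboolP => [/invertible_diag_op d0|].
- have {}d0 i : d i != 0 by apply: d0; exact: euclid_basis.
  have m0 : m != 0 by rewrite -(d_eq0 ord0).
  have nd0 i : 0 < Normc.normc (d i) by rewrite normc_gt0.
  have mp0 : 0 < m / p by rewrite -(normd ord0) exprn_gt0.
  have lnd i : ln (Normc.normc (d i)) *+ 2 = ln (m / p).
    by rewrite -lnXn // normd.
  rewrite trace_ln_abs_diag_op //; last exact: euclid_basis.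
  rewrite inver (negbTE m0) -EFinM /= -invf_div leNgt invr_gt0 mp0 /=.
  congr EFin; rewrite lnV ?posrE // big_ord_recl big_ord1.
  have -> : Normc.normc (d (lift ord0 ord0)) = Normc.normc (d ord0).
    by apply/eqP; rewrite -(eqrXn2 (n := 2)) ?ltW // !normd.
  by rewrite -(lnd ord0) mulr2n.
- move=> d0; have m0 : m = 0.
    apply/eqP; apply: contra_notT d0 => m0.
    by apply/invertible_diag_op => [|i]; [exact: euclid_basis | rewrite d_eq0].
  by rewrite m0 inver eqxx gt0_muley ?lte_fin.
Qed.
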